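(* For infinitely many odd composite integers $N$, the algorithm GP (described in the context), run on input $N$, finds a prime divisor of $N$, i.e. it terminates with an output $\gcd(D,N)$ that is a prime divisor of $N$, in time at most $O(\ln^{2} N)$. That is, there are an absolute constant $C$ and infinitely many odd composite $N$ such that on input $N$ the algorithm outputs a prime divisor of $N$ with total cost at most $C(\ln N)^2$.
   Context: Here $\ln$ denotes the logarithm to base $2$. For a positive integer $N$, a pair $(a,b)$ of positive integers is a graph pair for $N$ if $ab\equiv 1 \pmod N$. For an integer $x$, ''$x \,(\mathrm{mod}\ N)$'' used as a number denotes the remainder of $x$ on division by $N$. Algorithm GP, with input an odd integer $N>1$: 1. Let $j=0$. 2. Put $j=j+1$. 3. If $(N-1)/2^{j}$ is an integer, take the pair $((N-1)/a,\ N-a)$ with $a=(N-1)/2^{j}$. 4. Otherwise take the pair $(2^{j-1}\cdot 2,\ (b_{j-1}b_1)\,(\mathrm{mod}\ N))$. 5. Denote the pair obtained by $(2^{j},b_j)$. 6. Compute $D=|b_j-2^{j}|$. 7. If $2^{j}<N$, go to step 8; otherwise stop (with no output). 8. If $\gcd(D,N)=1$, go to step 2; otherwise print ''$N$ is composite'', print $\gcd(D,N)$ and $j$, and stop. Cost model: the running time is measured by the computations of $\gcd(D,N)$; each such computation costs $O(\ln N)$, so the total cost is $O(j\ln N)$, where $j$ is the number of iterations performed. *)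

(* Defs.v *)
From mathcomp Require Import all_boot all_order all_algebra.
From mathcomp Require Import all_classical all_reals all_analysis.

Set Implicit Arguments.
Unset Strict Implicit.
Unset Printing Implicit Defensive.

Import Order.TTheory GRing.Theory Num.Theory.
Local Open Scope ring_scope.

Definition log2 (R : realType) (x : R) : R := ln x / ln 2.

Definition composite (N : nat) : bool := (1 < N)%N && ~~ prime N.

Section AlgorithmGP.
Local Open Scope nat_scope.

(* Step 3; all divisions are exact when 2 ^ j divides N - 1. *)
Definition gp_direct (N j : nat) : nat * nat :=
  let a := (N - 1) %/ 2 ^ j in ((N - 1) %/ a, N - a).

(* Steps 3-5: the pair (2 ^ j, b_j). The algorithm only uses j >= 1, so the
   value at j = 0 is a dummy; b_1 always comes from step 3 because N is odd. *)
Fixpoint gp_pair (N j : nat) : nat * nat :=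
  if j is j'.+1 then
    if 2 ^ j %| N - 1 then gp_direct N j
    else (2 ^ j' * 2, ((gp_pair N j').2 * (gp_direct N 1).2) %% N)
  else (1, 1).

(* Step 6. *)
Definition gp_D (N j : nat) : nat := `|(gp_pair N j).2 - (gp_pair N j).1|.

End AlgorithmGP.

(* Big-step semantics of steps 2-8. [gp_eval cost N j out t]: the execution on
   input N that enters its j-th iteration terminates with output [out], and the
   gcd computations performed from then on have total cost t. Here [cost D N]
   is the cost of computing gcd(D, N); [out] is [Some (g, i)] when the message
   "N is composite" is printed along with g and i, and [None] when the
   algorithm stops without output. *)
Inductive gp_eval (R : realType) (cost : nat -> nat -> R) (N : nat) :
    nat -> option (nat * nat) -> R -> Prop :=
| gp_stop j :
    (N <= (gp_pair N j).1)%N ->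
    gp_eval cost N j None 0
| gp_print j :
    ((gp_pair N j).1 < N)%N -> gcdn (gp_D N j) N <> 1%N ->
    gp_eval cost N j (Some (gcdn (gp_D N j) N, j)) (cost (gp_D N j) N)
| gp_next j out t :
    ((gp_pair N j).1 < N)%N -> gcdn (gp_D N j) N = 1%N ->
    gp_eval cost N j.+1 out t ->
    gp_eval cost N j out (cost (gp_D N j) N + t).

Definition gp_run (R : realType) (cost : nat -> nat -> R) (N : nat) :
  option (nat * nat) -> R -> Prop := gp_eval cost N 1.

(* Main.v *)
(* gcd(D, N) = gcd(4 ^ j - 1, N) at iteration j, because b_j is the inverse of
   2 ^ j modulo N; hence every odd multiple of 3 yields the divisor 3 at the
   first iteration. *)

Require Import Defs.
From mathcomp Require Import all_boot all_order all_algebra.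
From mathcomp Require Import all_classical all_reals all_analysis.
From mathcomp Require Import zify.

Import Order.TTheory GRing.Theory Num.Theory.
Local Open Scope classical_set_scope.
Local Open Scope ring_scope.

Section OddMultiplesOfThree.
Local Open Scope nat_scope.

(** For N = 6k + 9 the first pair is (2, (N + 1) / 2), so D = (N - 3) / 2 = 3(k + 1) and N = 2D + 3.
    Hence gcd(D, N) = gcd(D, 3) = 3, and the run ends after a single gcd, of cost at most K log
    N. *)

Lemma gp_pair1 (N : nat) : odd N -> 1 < N -> gp_pair N 1 = (2, (N + 1) %/ 2).
Proof.
move=> oddN N_gt1; rewrite /gp_pair /gp_direct expn1.
(* Here k is the [a] of [gp_direct]; its positivity keeps [(N - 1) %/ a] from being a division by
   zero. *)
have [k [k_gt0 ->]] : exists k, 0 < k /\ N = k * 2 + 1 by exists (N %/ 2); lia.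
rewrite addnK dvdn_mull // mulnK // mulKn //; congr pair; lia.
Qed.

Lemma gcd_gp_D1 (k : nat) : gcdn (gp_D (6 * k + 9) 1) (6 * k + 9) = 3.
Proof.
rewrite /gp_D gp_pair1 /=; [|lia..].
set D := absz _; have -> : D = k.+1 * 3 by rewrite /D; lia.
have -> : 6 * k + 9 = 2 * (k.+1 * 3) + 3 by lia.
by rewrite gcdnMDl gcdnC; apply/gcdn_idPl; rewrite dvdn_mull.
Qed.

End OddMultiplesOfThree.

Lemma log2_ge1 (R : realType) (N : nat) : (1 < N)%N -> 1 <= log2 (N%:R : R).
Proof.
move=> N_gt1; rewrite /log2 ler_pdivlMr ?mul1r ?ln_gt0 ?ltr1n //.
by rewrite ler_ln ?posrE ?ltr0n ?ler_nat // ltnW.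
Qed.

Theorem mainTheorem1 (R : realType) (gcd_cost : nat -> nat -> R) (K : R)
    (gcd_cost_bound : forall D N : nat, (1 < N)%N -> (D < N)%N ->
       0 <= gcd_cost D N <= K * log2 (N%:R : R)) :
  exists C : R,
    infinite_set [set N : nat |
      [/\ odd N, composite N
        & exists (p j : nat) (t : R),
            [/\ gp_run gcd_cost N (Some (p, j)) t,
                prime p, (p %| N)%N
              & t <= C * (log2 (N%:R : R)) ^+ 2]]].
Proof.
have K_ge0 : 0 <= K.
  (* A single instance of the bound fixes the sign of K, since [log2 2] is positive. *)
  have /andP[c_ge0 /(le_trans c_ge0)] := gcd_cost_bound 0%N 2%N isT isT.
  by rewrite pmulr_lge0 // (lt_le_trans ltr01) ?log2_ge1.
(* The family starts at 9, leaving out 3, the only prime among the odd multiples of 3. *)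
exists K; apply: (@sub_infinite_set _ (range (fun k => 6 * k + 9)%N)); last first.
  rewrite /= (eq_finite_set (inj_card_eq _)); first exact: infinite_nat.
  by move=> k l _ _ /=; lia.
move=> _ [k _ <-] /=; set N := (6 * k + 9)%N.
have N_gt1 : (1 < N)%N by rewrite /N; lia.
have oddN : odd N by rewrite /N; lia.
have dvd3N : (3 %| N)%N by rewrite /N; lia.
have pairN : gp_pair N 1 = (2, (N + 1) %/ 2)%N := gp_pair1 N oddN N_gt1.
have gcd3 : gcdn (gp_D N 1) N = 3%N := gcd_gp_D1 k.
split=> //.
  rewrite /composite N_gt1; apply: contraTN dvd3N => primeN.
  by rewrite dvdn_prime2 // /N; lia.
exists 3%N, 1%N, (gcd_cost (gp_D N 1) N); split=> //.
  by rewrite -[in Some _]gcd3; apply: gp_print; rewrite ?gcd3 // pairN /N /=; lia.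
have D_lt : (gp_D N 1 < N)%N by rewrite /gp_D pairN /N /=; lia.
have /andP[_ /le_trans -> //] := gcd_cost_bound _ _ N_gt1 D_lt.
(* As log N is at least 1, it is at most its square. *)
by rewrite ler_wpM2l // expr2 ler_peMl ?log2_ge1 // (le_trans ler01) ?log2_ge1.
Qed.
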